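(* Let $f:\mathbb{R}^n\to\mathbb{R}$ be continuously differentiable, $g:\mathbb{R}^m\to(-\infty,+\infty]$ proper, convex and lower semicontinuous, $A\in\mathbb{R}^{m\times n}$, and $F(x)=f(x)+g(Ax)$. Suppose that $f$ is $L$-smooth and strongly convex with modulus $\mu>0$. Let $\{x^k\}$ be the sequence generated by the preconditioned proximal gradient method with conjugate momentum described in the context (with parameters $c_1,c_2,c_3,c_4,\sigma,\gamma$), and let $x^*$ be the minimizer of $F$. Then, for all $k\ge1$ (for which $x^{k+1}$ is generated), $$F(x^{k+1})-F(x^* )\le\left(1-\frac{\sigma}{4}\min\left\{\frac{\mu}{c_4},1\right\}\min\left\{\frac{c_3}{c_2},1\right\}\min\left\{\frac{\gamma(1-\sigma)c_1}{L},1\right\}\right)\left(F(x^{k})-F(x^* )\right).$$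
   Context: Notation: $\|\cdot\|$ is the Euclidean norm; $\|x\|_H=\sqrt{\langle x,Hx\rangle}$ for $H$ symmetric positive definite; $U\preceq V$ means $V-U$ is positive semidefinite; $\mathrm{dom}(g\circ A)=\{x:g(Ax)<+\infty\}$; $f$ is $L$-smooth if $\|\nabla f(x)-\nabla f(y)\|\le L\|x-y\|$ for all $x,y$; $f$ is $\mu$-strongly convex if $f(y)\ge f(x)+\nabla f(x)^\top(y-x)+\frac\mu2\|y-x\|^2$ for all $x,y$; $\mathbb{N}=\{0,1,2,\dots\}$. The method (preconditioned proximal gradient method with conjugate momentum). Inputs: $x^0\in\mathrm{dom}(g\circ A)$, constants $0<c_1\le c_2$, $0<c_3\le c_4$, $\sigma,\gamma\in(0,1)$, and a finite-difference parameter $\epsilon>0$. For $k=0,1,2,\dots$: 1. Choose any symmetric matrix $P_k$ with $c_3I_n\preceq P_k\preceq c_4I_n$. 2. Let $v_k$ be the solution of $\min_{v\in\mathbb{R}^n}\nabla f(x^k)^\top v+g(Ax^k+Av)+\frac12\|v\|_{P_k}^2$. If $v_k=0$, stop and return $x^k$. 3. If $k=0$, set $d_0=v_0$. If $k\ge1$: (a) Set $s_k=d_{k-1}$ if $x^k+d_{k-1}\in\mathrm{dom}(g\circ A)$, and otherwise $s_k=\Pi^{P_k}_{\mathrm{dom}(g\circ A)}(x^k+d_{k-1})-x^k$, where $\Pi_C^H(x)=\arg\min_{y\in C}\|y-x\|_H$ for a nonempty closed convex set $C$ (so $\mathrm{dom}(g\circ A)$ is understood to be closed whenever this second case is used). (b)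 For $v\in\mathbb{R}^n$ let $H_k(v)=\frac1\epsilon(\nabla f(x^k+\epsilon v)-\nabla f(x^k))$ and $$q_k(v)=\begin{cases}\max\{c_1,\min\{v^\top H_k(v)/\|v\|^2,\,c_2\}\}, & v^\top H_k(v)>0,\\ \max\{c_1,\min\{\|H_k(v)\|/\|v\|,\,c_2\}\}, & v^\top H_k(v)<0,\\ c_1, & v^\top H_k(v)=0.\end{cases}$$ (c) Set $\tilde s_k=s_k-\dfrac{s_k^\top H_k(v_k)}{q_k(v_k)\|v_k\|^2}v_k$. (d) Let $\alpha_1^k$ be a minimizer over $\alpha_1\in\mathbb{R}$ of $\nabla f(x^k)^\top v_k\,\alpha_1+g(Ax^k+\alpha_1Av_k)+\frac{q_k(v_k)}2\|v_k\|^2\alpha_1^2$, and $\alpha_2^k$ a minimizer over $\alpha_2\in\mathbb{R}$ of $\nabla f(x^k)^\top\tilde s_k\,\alpha_2+g(Ax^k+\alpha_2A\tilde s_k)+\frac{q_k(\tilde s_k)}2\|\tilde s_k\|^2\alpha_2^2$. (e) Set $\tilde d_k=\alpha_1^kv_k+\alpha_2^k\tilde s_k$ and $q_{k,d}=q_k(v_k)\|\alpha_1^kv_k\|^2+q_k(\tilde s_k)\|\alpha_2^k\tilde s_k\|^2$. (f) Let $\alpha_3^k$ be a minimizer over $\alpha_3\in\mathbb{R}$ of $\nabla f(x^k)^\top\tilde d_k\,\alpha_3+g(Ax^k+\alpha_3A\tilde d_k)+\frac{q_{k,d}}2\alpha_3^2$, and set $d_k=\alpha_3^k\tilde d_k$.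 4. Set $$t_k=\max\left\{\gamma^j:\ j\in\mathbb{N},\ F(x^k+\gamma^jd_k)-F(x^k)\le\sigma\gamma^j\left(\nabla f(x^k)^\top d_k+g(Ax^k+Ad_k)-g(Ax^k)\right)\right\}.$$ 5. Set $x^{k+1}=x^k+t_kd_k$. *)

(* Defs.v *)
From HB Require Import structures.
From mathcomp Require Import all_boot all_order all_algebra.
From mathcomp Require Import all_classical all_reals all_analysis.

Set Implicit Arguments.
Unset Strict Implicit.
Unset Printing Implicit Defensive.

Import Order.TTheory GRing.Theory Num.Theory.
Import numFieldNormedType.Exports.

Local Open Scope classical_set_scope.
Local Open Scope ring_scope.

Section Euclidean.
Variables (R : realType) (n : nat).
Implicit Types (u v : 'cV[R]_n) (H U V : 'M[R]_n).

Definition dotv u v : R := (u^T *m v) 0 0.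

(* The norm `|u| of the library on matrices is the sup norm, hence this one. *)
Definition enorm u : R := Num.sqrt (dotv u u).

Definition hnorm H u : R := Num.sqrt (dotv u (H *m u)).

Definition psdmx H : Prop := H^T = H /\ forall u, 0 <= dotv u (H *m u).

Definition loewner U V : Prop := psdmx (V - U).

Definition is_projection H (C : set 'cV[R]_n) u y : Prop :=
  C y /\ forall z, C z -> hnorm H (y - u) <= hnorm H (z - u).

End Euclidean.

Section Functions.
Variables (R : realType) (n : nat).
Implicit Types (f : 'cV[R]_n -> R) (h : 'cV[R]_n -> \bar R).

Definition grad f (x : 'cV[R]_n) : 'cV[R]_n :=
  \col_(i < n) 'D_(delta_mx i 0) f x.

Definition continuously_differentiable f : Prop :=
  (forall x, differentiable f x) /\ continuous (grad f).

Definition smooth_with (L : R) f : Prop :=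
  forall x y, enorm (grad f x - grad f y) <= L * enorm (x - y).

Definition strongly_convex (mu : R) f : Prop :=
  forall x y, f y >= f x + dotv (grad f x) (y - x)
                     + mu / 2 * enorm (y - x) ^+ 2.

Definition edom h : set 'cV[R]_n := [set x | (h x < +oo)%E].

Definition proper_efun h : Prop :=
  (forall x, h x != -oo%E) /\ (exists x, edom h x).

(* The conventions 0 * +oo = 0 and h > -oo (see proper_efun) make the
   right-hand side meaningful for every t in [0, 1]. *)
Definition convex_efun h : Prop :=
  forall (x y : 'cV[R]_n) (t : R), 0 <= t <= 1 ->
    (h (t *: x + (1 - t) *: y)%R <= t%:E * h x + (1 - t)%:E * h y)%E.

End Functions.

Definition is_minimizer (R : realType) (T : Type) (phi : T -> \bar R) (a : T)
  : Prop := forall b, (phi a <= phi b)%E.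

Section Method.
Variables (R : realType) (n m : nat).
Variables (f : 'cV[R]_n -> R) (g : 'cV[R]_m -> \bar R) (A : 'M[R]_(m, n)).
Variables (c1 c2 c3 c4 sigma gamma eps : R).
Implicit Types (x v w d s : 'cV[R]_n) (P : 'M[R]_n).

Definition objective x : \bar R := ((f x)%:E + g (A *m x))%E.

Definition dom_gA : set 'cV[R]_n := edom (fun x => g (A *m x)).

Definition prox_model x P v : \bar R :=
  ((dotv (grad f x) v)%:E + g (A *m x + A *m v)%R
   + (2^-1 * hnorm P v ^+ 2)%:E)%E.

Definition fd_hess x v : 'cV[R]_n :=
  eps^-1 *: (grad f (x + eps *: v) - grad f x).

Definition curvature x v : R :=
  let Hv := fd_hess x v in
  if 0 < dotv v Hv then
    Num.max c1 (Num.min (dotv v Hv / enorm v ^+ 2) c2)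
  else if dotv v Hv < 0 then
    Num.max c1 (Num.min (enorm Hv / enorm v) c2)
  else c1.

(* One-dimensional model along w; c is the full coefficient of a ^ 2 / 2. *)
Definition line_model x w (c a : R) : \bar R :=
  ((dotv (grad f x) w * a)%:E + g (A *m x + a *: (A *m w))%R
   + (c / 2 * a ^+ 2)%:E)%E.

Definition is_momentum x P d s : Prop :=
  (dom_gA (x + d) -> s = d) /\
  (~ dom_gA (x + d) -> closed dom_gA /\
     exists2 y, is_projection P dom_gA (x + d) y & s = y - x).

Definition conjugate_momentum x v s : 'cV[R]_n :=
  s - (dotv s (fd_hess x v) / (curvature x v * enorm v ^+ 2)) *: v.

(* dprev is the direction of the preceding iteration, d the new one. *)
Definition is_momentum_direction x P v dprev d : Prop :=
  exists s, exists a1 a2 a3 : R,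
    let s' := conjugate_momentum x v s in
    let d' := a1 *: v + a2 *: s' in
    let qd := curvature x v * enorm (a1 *: v) ^+ 2
              + curvature x s' * enorm (a2 *: s') ^+ 2 in
    [/\ is_momentum x P dprev s,
        is_minimizer (line_model x v (curvature x v * enorm v ^+ 2)) a1,
        is_minimizer (line_model x s' (curvature x s' * enorm s' ^+ 2)) a2,
        is_minimizer (line_model x d' qd) a3 &
        d = a3 *: d'].

Definition sufficient_decrease x d (t : R) : Prop :=
  (objective (x + t *: d)%R - objective x
   <= (sigma * t)%:E
      * ((dotv (grad f x) d)%:E + g (A *m x + A *m d)%R - g (A *m x)))%E.

Definition is_step_size x d (t : R) : Prop :=
  let S := [set gamma ^+ j | j in
             [set j : nat | sufficient_decrease x d (gamma ^+ j)]] in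
  S t /\ ubound S t.

(* The method does not stop at iteration k (v k != 0), and computes x k.+1. *)
Definition is_iteration (x : nat -> 'cV[R]_n) (P : nat -> 'M[R]_n)
    (v d : nat -> 'cV[R]_n) (t : nat -> R) (k : nat) : Prop :=
  [/\ [/\ (P k)^T = P k, loewner c3%:M (P k) & loewner (P k) c4%:M],
      is_minimizer (prox_model (x k) (P k)) (v k) /\ v k != 0,
      (if k is j.+1
       then is_momentum_direction (x k) (P k) (v k) (d j) (d k)
       else d k = v k),
      is_step_size (x k) (d k) (t k) &
      x k.+1 = x k + t k *: d k].

(* Iterations 0, ..., N - 1 are all completed, so that x 0, ..., x N are
   generated; the values of the sequences at later indices are irrelevant. *)
Definition is_run (N : nat) (x : nat -> 'cV[R]_n) (P : nat -> 'M[R]_n)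
    (v d : nat -> 'cV[R]_n) (t : nat -> R) : Prop :=
  dom_gA (x 0%N) /\ forall k, (k < N)%N -> is_iteration x P v d t k.

End Method.

(* Main.v *)
Require Import Defs.
From HB Require Import structures.
From mathcomp Require Import all_boot all_order all_algebra.
From mathcomp Require Import all_classical all_reals all_analysis.
From mathcomp Require Import ring lra.

(** Write [Delta(u)] for [<grad f x, u> + g (A (x + u)) - g (A x)], the change
    of the objective predicted at [x] along [u]; it is convex in [u] and
    vanishes at 0. The step [t d] decreases the objective by at least [- sigma
    t Delta(d)], so the rate follows from two bounds.

    The first is [Delta(d) <= - tau b gap / 2], where [tau] is the minimum of
    [mu / c4] and 1, [b] that of [c3 / c2] and 1, and [gap] is the excess of
    the objective at [x] over its minimum ([momentum_direction]). The
    preconditioned model at its minimiser [v] is at most its value at [tau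
    (xstar - x)]; convexity of [Delta], [P <= c4] and strong convexity of [f]
    bound the latter by [- tau gap] ([prox_direction_pred_change]). As [P >=
    c3] and the curvature estimates are at most [c2], the one-dimensional
    model along [v] takes at [b] a value at most [- tau b gap]. The last line
    search starts from a combination [a1 v + a2 s'] of the minimisers along
    [v] and along the conjugate direction [s']; its coefficient 1/2 gives the
    midpoint of the two, where the model is at most the mean of the two
    one-dimensional minima, the second of which is nonpositive
    ([two_direction_minimizer]).

    The second is [2 t >= min (gamma (1 - sigma) c1 / L) 1] ([step_size_ge]).
    Optimality of the last line search gives [Delta(d) <= - q], where [q / 2]
    is the value at [d] of the quadratic term of its model
    ([line_minimizer_pred_change]), and [2 q >= c1 |d|^2], because [d] is a
    sum of two vectors and both curvatures are at least [c1]. On the other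
    hand [f (x + u) <= f x + <grad f x, u> + L |u|^2] follows from convexity
    and the Lipschitz gradient alone ([smooth_convex_upper]). Hence every
    trial step [s <= 1] with [2 L s <= (1 - sigma) c1] satisfies the
    sufficient decrease condition. The factor lost against the descent lemma,
    whose constant is [L / 2], is covered by the constant 4 of the rate. *)

Set Implicit Arguments.
Unset Strict Implicit.
Unset Printing Implicit Defensive.

Import Order.TTheory GRing.Theory Num.Theory.
Import numFieldNormedType.Exports.

Local Open Scope classical_set_scope.
Local Open Scope ring_scope.

(** * Euclidean inner product and norm *)

Section EuclideanTheory.
Variables (R : realType) (n : nat).
Implicit Types (u v w : 'cV[R]_n) (P : 'M[R]_n) (a c : R).

Lemma dotvE u v : dotv u v = \sum_i u i 0 * v i 0.
Proof. by rewrite /dotv mxE; apply: eq_bigr => i _; rewrite mxE. Qed.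

Lemma dotvC u v : dotv u v = dotv v u.
Proof. by rewrite !dotvE; apply: eq_bigr => i _; rewrite mulrC. Qed.

Lemma dotvDr u v w : dotv u (v + w) = dotv u v + dotv u w.
Proof. by rewrite /dotv mulmxDr mxE. Qed.

Lemma dotvZr u a v : dotv u (a *: v) = a * dotv u v.
Proof. by rewrite /dotv -scalemxAr mxE. Qed.

Lemma dotvBr u v w : dotv u (v - w) = dotv u v - dotv u w.
Proof. by rewrite -[- w]scaleN1r dotvDr dotvZr mulN1r. Qed.

Lemma dotv0r u : dotv u 0 = 0.
Proof. by rewrite -[0]subr0 dotvBr subrr. Qed.

Lemma dotvDl u v w : dotv (v + w) u = dotv v u + dotv w u.
Proof. by rewrite ![dotv _ u]dotvC dotvDr. Qed.

Lemma dotvZl u a v : dotv (a *: v) u = a * dotv v u.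
Proof. by rewrite ![dotv _ u]dotvC dotvZr. Qed.

Lemma dotvBl u v w : dotv (v - w) u = dotv v u - dotv w u.
Proof. by rewrite ![dotv _ u]dotvC dotvBr. Qed.

Lemma dotv_ge0 u : 0 <= dotv u u.
Proof. by rewrite dotvE; apply: sumr_ge0 => i _; rewrite -expr2 sqr_ge0. Qed.

Lemma sqr_enorm u : enorm u ^+ 2 = dotv u u.
Proof. by rewrite /enorm sqr_sqrtr ?dotv_ge0. Qed.

Lemma enormZ_sqr a u : enorm (a *: u) ^+ 2 = a ^+ 2 * enorm u ^+ 2.
Proof. by rewrite !sqr_enorm dotvZl dotvZr mulrA. Qed.

Lemma enormD_sqr_le u v :
  enorm (u + v) ^+ 2 <= 2 * (enorm u ^+ 2 + enorm v ^+ 2).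
Proof.
have := dotv_ge0 (u - v).
rewrite !sqr_enorm !(dotvBl, dotvBr, dotvDl, dotvDr) (dotvC v u); lra.
Qed.

Lemma loewner_dotv (U V : 'M[R]_n) u :
  loewner U V -> dotv u (U *m u) <= dotv u (V *m u).
Proof. by case=> _ /(_ u); rewrite mulmxBl dotvBr subr_ge0. Qed.

Lemma dotv_scalar_mx a u : dotv u (a%:M *m u) = a * enorm u ^+ 2.
Proof. by rewrite mul_scalar_mx dotvZr sqr_enorm. Qed.

Lemma loewner_hnorm c c' P u : 0 <= c ->
    loewner c%:M P -> loewner P c'%:M ->
  c * enorm u ^+ 2 <= hnorm P u ^+ 2 <= c' * enorm u ^+ 2.
Proof.
move=> c0 /(loewner_dotv u) + /(loewner_dotv u).
rewrite !dotv_scalar_mx => cP Pc'.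
have Pu : 0 <= dotv u (P *m u).
  by apply: le_trans cP; rewrite mulr_ge0 ?sqr_ge0.
have -> : hnorm P u ^+ 2 = dotv u (P *m u) by rewrite /hnorm sqr_sqrtr.
by rewrite cP Pc'.
Qed.

(** From [0 <= |u - L v|^2]; this is the only form of the Cauchy-Schwarz
    inequality that the argument needs. *)
Lemma dotv_le_of_enorm_le (L : R) u v : 0 < L -> enorm u <= L * enorm v ->
  dotv u v <= L * enorm v ^+ 2.
Proof.
move=> L0 uLv.
have uLv2 : enorm u ^+ 2 <= L ^+ 2 * enorm v ^+ 2.
  by rewrite -exprMn ler_sqr ?nnegrE ?mulr_ge0 ?sqrtr_ge0 // ltW.
have := dotv_ge0 (u - L *: v).
rewrite !(dotvBl, dotvBr, dotvZl, dotvZr) (dotvC v u) -!sqr_enorm => H.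
rewrite -(ler_pM2l L0); nra.
Qed.

End EuclideanTheory.

Section MethodTheory.
Variables (R : realType) (n m : nat).
Variables (f : 'cV[R]_n -> R) (g : 'cV[R]_m -> \bar R) (A : 'M[R]_(m, n)).
Hypothesis g_proper : proper_efun g.
Hypothesis g_convex : convex_efun g.
Implicit Types (x y u v w d s : 'cV[R]_n) (P : 'M[R]_n).
Implicit Types (a b c q t L mu eps sigma gamma : R).

Local Notation D := (dom_gA g A).

(** * The predicted change of the objective *)

(** The predicted change of the objective from [x] to [x + u]: [f] is
    linearised and [g] kept exact. It is meaningful when [x] and [x + u] lie in
    the domain; outside, [fine] replaces the infinite values by 0. *)
Definition pred_change x u : R :=
  dotv (grad f x) u + fine (g (A *m (x + u))) - fine (g (A *m x)).

(** The objective as a real number, for points of the domain. *)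
Definition robjective x : R := f x + fine (g (A *m x)).

Lemma dom_fine x : D x -> g (A *m x) = (fine (g (A *m x)))%:E.
Proof.
move=> Dx; rewrite fineK // fin_numE (proj1 g_proper) /=.
by move: Dx; rewrite /dom_gA /edom /= lt_neqAle => /andP[].
Qed.

Lemma robjectiveE x : D x -> objective f g A x = (robjective x)%:E.
Proof. by move=> /dom_fine Dx; rewrite /objective Dx /robjective. Qed.

Lemma pred_change0 x : pred_change x 0 = 0.
Proof. by rewrite /pred_change addr0 dotv0r add0r subrr. Qed.

Lemma pred_change_convex x u w t : D (x + u) -> D (x + w) -> 0 <= t <= 1 ->
  D (x + (t *: u + (1 - t) *: w)) /\
  pred_change x (t *: u + (1 - t) *: w)
    <= t * pred_change x u + (1 - t) * pred_change x w.
Proof.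
move=> Du Dw t01.
have := g_convex (A *m (x + u)) (A *m (x + w)) t01.
have xuw : t *: (x + u) + (1 - t) *: (x + w) = x + (t *: u + (1 - t) *: w).
  by rewrite !scalerDr addrACA -scalerDl (addrC t) subrK scale1r.
rewrite !scalemxAr -mulmxDr xuw.
rewrite (dom_fine Du) (dom_fine Dw) -!EFinM -EFinD => gle.
have Dc : D (x + (t *: u + (1 - t) *: w)) by apply: le_lt_trans gle (ltry _).
split=> //; move: gle; rewrite (dom_fine Dc) lee_fin /pred_change.
rewrite dotvDr !dotvZr; lra.
Qed.

Lemma pred_change_scale x u t : D x -> D (x + u) -> 0 <= t <= 1 ->
  D (x + t *: u) /\ pred_change x (t *: u) <= t * pred_change x u.
Proof.
move=> Dx Du t01; have := @pred_change_convex x u 0 t Du.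
by rewrite addr0 scaler0 addr0 pred_change0 mulr0 addr0; apply.
Qed.

(** * Minimisers of the models *)

Lemma line_modelE x w c a : D x -> D (x + a *: w) ->
  line_model f g A x w c a
    = (pred_change x (a *: w) + c / 2 * a ^+ 2 + fine (g (A *m x)))%:E.
Proof.
move=> Dx Da; rewrite /line_model scalemxAr -mulmxDr (dom_fine Da) -!EFinD.
by congr EFin; rewrite /pred_change dotvZr; ring.
Qed.

Lemma line_minimizer x w c a : D x -> is_minimizer (line_model f g A x w c) a ->
  D (x + a *: w) /\ forall b, D (x + b *: w) ->
    pred_change x (a *: w) + c / 2 * a ^+ 2
      <= pred_change x (b *: w) + c / 2 * b ^+ 2.
Proof.
move=> Dx amin.
have Da : D (x + a *: w).
  have D0 : D (x + 0 *: w) by rewrite scale0r addr0.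
  have := amin 0; rewrite (line_modelE c Dx D0) /line_model scalemxAr -mulmxDr.
  rewrite /dom_gA /edom /=; case: (g (A *m (x + a *: w)))
    (proj1 g_proper (A *m (x + a *: w))) => //= r.
  by move=> _; rewrite ltry.
split=> // b Db; have := amin b.
by rewrite !line_modelE // lee_fin lerD2r.
Qed.

Lemma prox_modelE x P w : D x -> D (x + w) ->
  prox_model f g A x P w
    = (pred_change x w + 2^-1 * hnorm P w ^+ 2 + fine (g (A *m x)))%:E.
Proof.
move=> Dx Dw; rewrite /prox_model -mulmxDr (dom_fine Dw) -!EFinD.
by congr EFin; rewrite /pred_change; ring.
Qed.

Lemma prox_minimizer x P v : D x -> is_minimizer (prox_model f g A x P) v ->
  D (x + v) /\ forall w, D (x + w) ->
    pred_change x v + 2^-1 * hnorm P v ^+ 2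
      <= pred_change x w + 2^-1 * hnorm P w ^+ 2.
Proof.
move=> Dx vmin.
have Dv : D (x + v).
  have D0 : D (x + 0) by rewrite addr0.
  have := vmin 0; rewrite (prox_modelE P Dx D0) /prox_model -mulmxDr.
  rewrite /dom_gA /edom /=; case: (g (A *m (x + v)))
    (proj1 g_proper (A *m (x + v))) => //= r.
  by move=> _; rewrite ltry.
split=> // w Dw; have := vmin w.
by rewrite !prox_modelE // lee_fin lerD2r.
Qed.

(** First-order optimality of [a], obtained by comparing it with [(1 - h) a]
    for small [h > 0]. *)
Lemma line_minimizer_pred_change x w c a : D x -> 0 <= c ->
    is_minimizer (line_model f g A x w c) a ->
  pred_change x (a *: w) <= - (c * a ^+ 2).
Proof.
move=> Dx c0 /(line_minimizer Dx)[Da amin].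
set q := c * a ^+ 2; have q0 : 0 <= q by rewrite mulr_ge0 ?sqr_ge0.
apply/ler_addgt0Pr => e e0.
(* With h (q + e) = e, the comparison with (1 - h) a loses at most e. *)
have qe : 0 < q + e by rewrite ltr_wpDl.
set h := e / (q + e); have h0 : 0 < h by rewrite divr_gt0.
have hqe : h * (q + e) = e by rewrite divfK ?gt_eqF.
have h1 : h <= 1 by rewrite ler_pdivrMr // mul1r lerDr.
have t01 : 0 <= 1 - h <= 1 by lra.
have [Dt le_t] := pred_change_scale Dx Da t01.
have := amin ((1 - h) * a); rewrite -scalerA => /(_ Dt).
have -> : c / 2 * ((1 - h) * a) ^+ 2 = (1 - h) ^+ 2 * (q / 2).
  by rewrite /q; ring.
have -> : c / 2 * a ^+ 2 = q / 2 by rewrite /q; ring.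
move=> le_a.
have : h * pred_change x (a *: w) <= h * (- q + e).
  have hq : h * q <= e by rewrite -[leRHS]hqe ler_wpM2l ?lerDl ?ltW.
  have := ler_wpM2l (ltW h0) hq.
  have : 0 <= h * (h * q) := mulr_ge0 (ltW h0) (mulr_ge0 (ltW h0) q0).
  lra.
by rewrite ler_pM2l.
Qed.

(** * Decrease along the search directions *)

Lemma curvature_bounds c1 c2 eps x w : c1 <= c2 ->
  c1 <= curvature f c1 c2 eps x w <= c2.
Proof.
move=> c12; rewrite /curvature.
by case: ifP => _; [|case: ifP => _];
  rewrite ?le_max ?ge_max ?ge_min ?lexx ?c12 ?orbT.
Qed.

(** The minimum along [a1 w1 + a2 w2] is compared with the midpoint of
    [a1 w1] and [a2 w2], which keeps half of the decrease along each; the one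
    along [w2] is only known to be nonnegative. *)
Lemma two_direction_minimizer x w1 w2 c1' c2' a1 a2 a3 :
    D x -> 0 <= c1' -> 0 <= c2' ->
    is_minimizer (line_model f g A x w1 c1') a1 ->
    is_minimizer (line_model f g A x w2 c2') a2 ->
    is_minimizer (line_model f g A x (a1 *: w1 + a2 *: w2)
      (c1' * a1 ^+ 2 + c2' * a2 ^+ 2)) a3 ->
  forall b, D (x + b *: w1) ->
  pred_change x (a3 *: (a1 *: w1 + a2 *: w2))
    <= 2^-1 * (pred_change x (b *: w1) + c1' / 2 * b ^+ 2).
Proof.
move=> Dx c10 c20 /(line_minimizer Dx)[D1 min1].
move=> /(line_minimizer Dx)[D2 min2] /(line_minimizer Dx)[D3 min3].
move=> b Db; have {min1} := min1 b Db.
have := min2 0; rewrite scale0r addr0 pred_change0 => /(_ Dx) le2 le1.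
(* The model at the coefficient 1/2 is evaluated at the midpoint. *)
have half01 : 0 <= (2^-1 : R) <= 1 by lra.
have [] := @pred_change_convex x _ _ 2^-1 D1 D2 half01.
rewrite (_ : 1 - 2^-1 = 2^-1 :> R); last by lra.
rewrite -scalerDr => Dh leh; have := min3 _ Dh.
have q1 : 0 <= c1' * a1 ^+ 2 by rewrite mulr_ge0 ?sqr_ge0.
have q2 : 0 <= c2' * a2 ^+ 2 by rewrite mulr_ge0 ?sqr_ge0.
have : 0 <= (c1' * a1 ^+ 2 + c2' * a2 ^+ 2) / 2 * a3 ^+ 2.
  by rewrite mulr_ge0 ?sqr_ge0 // divr_ge0 // addr_ge0.
move: le1 le2 leh q1 q2; set q1 := c1' * a1 ^+ 2; set q2 := c2' * a2 ^+ 2.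
rewrite [c1' / 2 * a1 ^+ 2](_ : _ = q1 / 2); last by rewrite /q1; ring.
rewrite [c2' / 2 * a2 ^+ 2](_ : _ = q2 / 2); last by rewrite /q2; ring.
lra.
Qed.

(** The one-dimensional model along the preconditioned proximal direction [v]
    decreases, at the point [b = min (c3 / c2) 1], by at least a fixed fraction
    of the gap between [x] and any [y] that is not worse; for the gap,
    the preconditioned model is compared at [min (mu / c4) 1 *: (y - x)]. *)
Lemma prox_direction_pred_change x y P v q mu c2 c3 c4 :
    D x -> D y -> 0 < mu -> 0 < c2 -> 0 < c3 -> c3 <= c4 -> q <= c2 ->
    strongly_convex mu f -> loewner c3%:M P -> loewner P c4%:M ->
    is_minimizer (prox_model f g A x P) v -> robjective y <= robjective x ->
  exists2 b, D (x + b *: v) &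
    pred_change x (b *: v) + q * enorm v ^+ 2 / 2 * b ^+ 2
      <= Num.min (mu / c4) 1 * Num.min (c3 / c2) 1
         * (robjective y - robjective x).
Proof.
move=> Dx Dy mu0 c20 c30 c34 qc2 sc P3 P4 /(prox_minimizer Dx)[Dv vmin] yx.
have c40 : 0 < c4 by apply: lt_le_trans c34.
set tau := Num.min (mu / c4) 1; set b := Num.min (c3 / c2) 1.
have tau01 : 0 <= tau <= 1.
  by rewrite /tau le_min ge_min lexx ler01 orbT divr_ge0 ?ltW.
have b01 : 0 <= b <= 1.
  by rewrite /b le_min ge_min lexx ler01 orbT divr_ge0 ?ltW.
have tau_c4 : tau * c4 <= mu by rewrite -ler_pdivlMr // /tau ge_min lexx.
have b_c2 : b * c2 <= c3 by rewrite -ler_pdivlMr // /b ge_min lexx.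
have [Db le_b] := pred_change_scale Dx Dv b01.
exists b => //.
have Dxy : D (x + (y - x)) by rewrite addrC subrK.
have [Dt le_t] := pred_change_scale Dx Dxy tau01.
have := vmin _ Dt.
have /andP[+ _] := loewner_hnorm v (ltW c30) P3 P4.
have /andP[_] := loewner_hnorm (tau *: (y - x)) (ltW c30) P3 P4.
rewrite enormZ_sqr.
have := sc x y; have : pred_change x (y - x) = dotv (grad f x) (y - x)
    + (robjective y - f y) - (robjective x - f x).
  by rewrite /pred_change (addrC x) subrK /robjective; ring.
set e := enorm (y - x) ^+ 2; set ev := enorm v ^+ 2.
have e0 : 0 <= e by rewrite sqr_ge0.
have ev0 : 0 <= ev by rewrite sqr_ge0.
move: le_b le_t; set pv := pred_change x v; set pt := pred_change x (tau *: _).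
set pb := pred_change x _; set py := pred_change x _; set hv := hnorm P v ^+ 2.
set ht := hnorm P _ ^+ 2; set G := robjective y - robjective x.
move=> le_b le_t pyE sc_y ht_le hv_ge v_le.
have py_le : py + mu / 2 * e <= G by rewrite /G; lra.
have ht_le' : ht <= tau * (mu * e).
  have te0 : 0 <= tau * e by rewrite mulr_ge0 //; lra.
  have := ler_wpM2l te0 tau_c4; lra.
have M_le : pv + 2^-1 * hv <= tau * G.
  have : tau * (py + mu / 2 * e) <= tau * G by rewrite ler_wpM2l //; lra.
  lra.
have : b * (pv + 2^-1 * hv) <= b * (tau * G) by rewrite ler_wpM2l //; lra.
have : b * (b * (q * ev)) <= b * hv.
  rewrite ler_wpM2l //; first by lra.
  apply: le_trans hv_ge; rewrite mulrA ler_wpM2r //.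
  apply: le_trans b_c2; rewrite ler_wpM2l //; lra.
nra.
Qed.

(** * Step sizes *)

(** Convexity at [x + u] replaces integration along the segment, at the price
    of a factor 2 in the quadratic term compared with the descent lemma. *)
Lemma smooth_convex_upper L mu x u : 0 < L -> 0 < mu ->
    smooth_with L f -> strongly_convex mu f ->
  f (x + u) <= f x + dotv (grad f x) u + L * enorm u ^+ 2.
Proof.
move=> L0 mu0 sm sc.
have := sc (x + u) x; have := sm (x + u) x.
rewrite (addrC x u) addrK => /(dotv_le_of_enorm_le L0).
rewrite dotvBl opprD addrA addrAC subrr add0r -[- u]scaleN1r dotvZr enormZ_sqr.
by have := sqr_ge0 (enorm u); nra.
Qed.

Lemma sufficient_decreaseE sigma x d t : D x -> D (x + d) -> D (x + t *: d) ->
  sufficient_decrease f g A sigma x d t <->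
  robjective (x + t *: d) - robjective x <= sigma * t * pred_change x d.
Proof.
move=> Dx Dd Dt; rewrite /sufficient_decrease -mulmxDr !robjectiveE //.
by rewrite (dom_fine Dd) (dom_fine Dx) -EFinB -EFinD -EFinM lee_fin.
Qed.

Lemma exprn_01 (gamma : R) j : 0 < gamma < 1 -> 0 <= gamma ^+ j <= 1.
Proof. by move=> /andP[g0 g1]; rewrite exprn_ge0 ?exprn_ile1 // ltW. Qed.

Lemma step_size_decrease sigma gamma x d t : 0 < gamma < 1 ->
    D x -> D (x + d) -> is_step_size f g A sigma gamma x d t ->
  [/\ 0 < t, D (x + t *: d) &
    robjective (x + t *: d) - robjective x <= sigma * t * pred_change x d].
Proof.
move=> g01 Dx Dd [[j /= sd <-] _].
have [Dt _] := pred_change_scale Dx Dd (exprn_01 j g01).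
split=> //; last exact/sufficient_decreaseE.
by rewrite exprn_gt0 //; case/andP: g01.
Qed.

(** A trial step [s <= 1] is rejected only if it exceeds
    [(1 - sigma) c1 / (2 L)]; apply this to the one before [t]. *)
Lemma step_size_ge L mu sigma gamma c1 x d t :
    0 < L -> 0 < mu -> 0 < sigma < 1 -> 0 < gamma < 1 -> 0 < c1 ->
    smooth_with L f -> strongly_convex mu f ->
    D x -> D (x + d) -> 2 * pred_change x d <= - (c1 * enorm d ^+ 2) ->
    is_step_size f g A sigma gamma x d t ->
  Num.min (gamma * (1 - sigma) * c1 / L) 1 <= 2 * t.
Proof.
move=> L0 mu0 s01 g01 c10 sm sc Dx Dd pd [[[|j] /= sd <-] ub].
  by rewrite expr0 ge_min; apply/orP; right; lra.
have g0 : 0 < gamma by case/andP: g01.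
set s := gamma ^+ j; have s0 : 0 < s by rewrite exprn_gt0.
have [Ds le_s] := pred_change_scale Dx Dd (exprn_01 j g01).
(* The step s is larger than t = gamma s, the largest accepted one. *)
have nsd : ~ sufficient_decrease f g A sigma x d s.
  move=> sds; have : s <= gamma * s.
    by rewrite -exprS; apply: ub; exists j.
  by apply/negP; rewrite -ltNge gtr_pMl //; case/andP: g01.
rewrite ge_min; apply/orP; left; rewrite exprS -/s ler_pdivrMr //.
rewrite leNgt; apply/negP => small; apply: nsd.
apply/sufficient_decreaseE => //.
have small' : 2 * (L * s) <= (1 - sigma) * c1.
  rewrite -(ler_pM2l g0); lra.
have up := @smooth_convex_upper L mu x (s *: d) L0 mu0 sm sc.
move: le_s up; rewrite -/s /robjective /pred_change enormZ_sqr.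
set e := enorm d ^+ 2; set G := dotv _ d + _ - _.
have e0 : 0 <= e by rewrite sqr_ge0.
move=> le_s up.
have : 2 * (L * s) * e <= (1 - sigma) * (- 2 * G).
  apply: (@le_trans _ _ ((1 - sigma) * (c1 * e))).
    by rewrite [leRHS]mulrA ler_wpM2r.
  rewrite ler_wpM2l //; first by lra.
  by move: pd; rewrite -/e /pred_change -/G; lra.
move=> /(ler_wpM2l (ltW s0)); lra.
Qed.

(** * The momentum step and the iterates *)

(** The second conjunct is what bounds the step size from below, the third
    compares the predicted change with the gap to [y]. *)
Lemma momentum_direction mu c1 c2 c3 c4 eps x y P v dprev d :
    0 < mu -> 0 < c1 -> c1 <= c2 -> 0 < c3 -> c3 <= c4 ->
    strongly_convex mu f -> D x -> D y -> robjective y <= robjective x ->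
    loewner c3%:M P -> loewner P c4%:M ->
    is_minimizer (prox_model f g A x P) v ->
    is_momentum_direction f g A c1 c2 eps x P v dprev d ->
  [/\ D (x + d), 2 * pred_change x d <= - (c1 * enorm d ^+ 2) &
    2 * pred_change x d <= Num.min (mu / c4) 1 * Num.min (c3 / c2) 1
                           * (robjective y - robjective x)].
Proof.
move=> mu0 c10 c12 c30 c34 sc Dx Dy yx P3 P4 vmin [s [a1 [a2 [a3 /=]]]].
set s' := conjugate_momentum _ _ _ _ _ _ _.
set qv := curvature _ _ _ _ _ v; set qs := curvature _ _ _ _ _ s'.
move=> [_ min1 min2 min3 ->].
have /andP[qv1 qv2] : c1 <= qv <= c2 by apply: curvature_bounds.
have /andP[qs1 qs2] : c1 <= qs <= c2 by apply: curvature_bounds.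
set d' := a1 *: v + a2 *: s' in min3 *.
have qv0 : 0 <= qv by rewrite (le_trans (ltW c10)).
have qs0 : 0 <= qs by rewrite (le_trans (ltW c10)).
have qd0 : 0 <= qv * enorm (a1 *: v) ^+ 2 + qs * enorm (a2 *: s') ^+ 2.
  by rewrite addr_ge0 // mulr_ge0 ?sqr_ge0.
have [D3 _] := line_minimizer Dx min3.
split=> //.
  have := line_minimizer_pred_change Dx qd0 min3.
  rewrite (enormZ_sqr a3); set p := pred_change _ _ => p_le.
  have d'_le := enormD_sqr_le (a1 *: v) (a2 *: s'); rewrite -/d' in d'_le.
  have : c1 * enorm d' ^+ 2 * a3 ^+ 2
      <= 2 * (qv * enorm (a1 *: v) ^+ 2 + qs * enorm (a2 *: s') ^+ 2) * a3 ^+ 2.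
    rewrite ler_wpM2r ?sqr_ge0 //.
    apply: le_trans (ler_wpM2l (ltW c10) d'_le) _.
    have := ler_wpM2r (sqr_ge0 (enorm (a1 *: v))) qv1.
    have := ler_wpM2r (sqr_ge0 (enorm (a2 *: s'))) qs1.
    lra.
  lra.
have [b Db le_b] := @prox_direction_pred_change x y P v qv mu c2 c3 c4 Dx Dy mu0
  (lt_le_trans c10 c12) c30 c34 qv2 sc P3 P4 vmin yx.
have min3' : is_minimizer (line_model f g A x d'
    (qv * enorm v ^+ 2 * a1 ^+ 2 + qs * enorm s' ^+ 2 * a2 ^+ 2)) a3.
  move: min3; rewrite !enormZ_sqr.
  by rewrite (mulrCA qv) (mulrCA qs) ![in X in X -> _](mulrC (_ ^+ 2) (_ * _)).
have qv'0 : 0 <= qv * enorm v ^+ 2 by rewrite mulr_ge0 ?sqr_ge0.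
have qs'0 : 0 <= qs * enorm s' ^+ 2 by rewrite mulr_ge0 ?sqr_ge0.
have := two_direction_minimizer Dx qv'0 qs'0 min1 min2 min3' Db.
rewrite -/d'; lra.
Qed.

(** Iterates stay in the domain, where the objective is finite. *)
Lemma iteration_dom c1 c2 c3 c4 sigma gamma eps (N : nat)
    (x : nat -> 'cV[R]_n) (P : nat -> 'M[R]_n) (v d : nat -> 'cV[R]_n)
    (t : nat -> R) :
    0 < gamma < 1 ->
    is_run f g A c1 c2 c3 c4 sigma gamma eps N x P v d t ->
  forall k, (k <= N)%N -> D (x k).
Proof.
move=> g01 [Dx0 it]; elim=> [//|k IH] kN; have Dk := IH (ltnW kN).
have [_ [vmin _] dk sk ->] := it k kN.
suff Dd : D (x k + d k) by case: (step_size_decrease g01 Dk Dd sk).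
case: k dk {IH kN sk} vmin Dk => [->|k].
  by move=> vmin Dk; case: (prox_minimizer Dk vmin).
move=> [s [a1 [a2 [a3 /= [_ _ _ min3 ->]]]]] _ Dk.
by case: (line_minimizer Dk min3).
Qed.

End MethodTheory.

(** * Linear convergence *)

Theorem theorem2 (R : realType) (n m : nat)
    (f : 'cV[R]_n -> R) (g : 'cV[R]_m -> \bar R) (A : 'M[R]_(m, n))
    (L mu c1 c2 c3 c4 sigma gamma eps : R)
    (x : nat -> 'cV[R]_n) (P : nat -> 'M[R]_n)
    (v d : nat -> 'cV[R]_n) (t : nat -> R) (N : nat)
    (xstar : 'cV[R]_n)
    (f_C1 : continuously_differentiable f)
    (g_proper : proper_efun g)
    (g_convex : convex_efun g)
    (g_lsc : lower_semicontinuous g)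
    (f_smooth : smooth_with L f)
    (mu_gt0 : 0 < mu)
    (f_strongly_convex : strongly_convex mu f)
    (c1_gt0 : 0 < c1) (c1_le_c2 : c1 <= c2)
    (c3_gt0 : 0 < c3) (c3_le_c4 : c3 <= c4)
    (sigma_01 : 0 < sigma < 1) (gamma_01 : 0 < gamma < 1)
    (eps_gt0 : 0 < eps)
    (run : is_run f g A c1 c2 c3 c4 sigma gamma eps N x P v d t)
    (xstar_min : is_minimizer (objective f g A) xstar) :
  forall k : nat, (1 <= k)%N -> (k < N)%N ->
    (objective f g A (x k.+1) - objective f g A xstar
     <= (1 - sigma / 4 * Num.min (mu / c4) 1 * Num.min (c3 / c2) 1
             * Num.min (gamma * (1 - sigma) * c1 / L) 1)%R%:E
        * (objective f g A (x k) - objective f g A xstar))%E.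
Proof.
move=> [//|k] _ kN.
have Dx := iteration_dom g_proper g_convex gamma_01 run.
have Dk := Dx _ (ltnW kN).
have Ds : dom_gA g A xstar.
  have := xstar_min (x k.+1); rewrite (robjectiveE f g_proper Dk).
  rewrite /objective /dom_gA /edom /=.
  case: (g (A *m xstar)) (proj1 g_proper (A *m xstar)) => //= r.
  by move=> _; rewrite ltry.
have Dk1 := Dx _ kN.
rewrite !(robjectiveE f g_proper) // -!EFinB -EFinM lee_fin.
have sx : robjective f g A xstar <= robjective f g A (x k.+1).
  by have := xstar_min (x k.+1); rewrite !(robjectiveE f g_proper).
have [_ it] := run; have [[_ P3 P4] [vmin _] dk sk xk] := it _ kN.
have [Dd pd1 pd2] := momentum_direction g_proper g_convex
  mu_gt0 c1_gt0 c1_le_c2 c3_gt0 c3_le_c4 f_strongly_convex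
  Dk Ds sx P3 P4 vmin dk.
have [t0 _ dec] := step_size_decrease g_proper g_convex gamma_01 Dk Dd sk.
rewrite -xk in dec.
set w := Num.min (gamma * (1 - sigma) * c1 / L) 1.
have w_le : w <= 2 * t k.+1.
  have [L0|L0] := ltP 0 L.
    exact: step_size_ge mu_gt0 sigma_01 gamma_01 c1_gt0 f_smooth
      f_strongly_convex Dk Dd pd1 sk.
  (* For L <= 0, w <= 0 and the bound is trivial. *)
  apply: (@le_trans _ _ 0); last by rewrite mulr_ge0 // ltW.
  rewrite ge_min; apply/orP; left; rewrite mulr_ge0_le0 ?invr_le0 //.
  rewrite !mulr_ge0 ?subr_ge0 // ltW //.
    by case/andP: gamma_01.
  by case/andP: sigma_01.
have c2_gt0 : 0 < c2 := lt_le_trans c1_gt0 c1_le_c2.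
have c4_gt0 : 0 < c4 := lt_le_trans c3_gt0 c3_le_c4.
rewrite -[sigma / 4 * _ * _]mulrA.
move: sx dec pd2; set M := Num.min (mu / c4) 1 * _.
have M0 : 0 <= M by rewrite mulr_ge0 // le_min ler01 andbT divr_ge0 ?ltW.
set F1 := robjective f g A (x k.+2); set F0 := robjective f g A (x k.+1).
set Fs := robjective f g A _; set p := pred_change _ _ _ _ _ => sx dec pd2.
have s0 : 0 < sigma by case/andP: sigma_01.
have Mgap : 0 <= M * (F0 - Fs) by rewrite mulr_ge0 // subr_ge0.
have step1 := ler_wpM2l (ltW (mulr_gt0 s0 t0)) pd2.
have step2 := ler_wpM2l (ltW s0) (ler_wpM2r Mgap w_le).
lra.
Qed.
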